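(* Let $n\ge2$, $k\ge2$, let $V_n$ be the $n$-dimensional $\mathbb{Q}(v,t)$-vector space with basis $v_1,\dots,v_n$, and let $R\in\mathrm{End}(V_n\otimes V_n)$ be $$R=\sum_{i<j}t^2E_{j,i}\otimes E_{i,j}+\sum_{i<j}E_{i,j}\otimes E_{j,i}+(v^{-1}-v)t\sum_{i<j}E_{j,j}\otimes E_{i,i}+v^{-1}t\sum_iE_{i,i}\otimes E_{i,i}.$$ For $1\le i<k$ let $R_i$ be the operator on $V_n^{\otimes k}$ acting as $R$ on the $i$-th and $(i+1)$-st tensor factors and as the identity on the others. Then setting $\delta_n(T_i)=R_i$ for $1\le i<k$ defines a representation $(\delta_n,V_n^{\otimes k})$ of the Hecke algebra $H_k(v,t)$; that is, the $k$-fold tensor power $V_n^{\otimes k}$ of the natural representation of $U_{v,t}(sl_n)$ affords a representation of $H_k(v,t)$.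
   Context: $v,t$ are formal variables. $E_{i,j}$ is the $n\times n$ matrix unit (entry $1$ in row $i$, column $j$, zeros elsewhere), so $E_{i,j}v_j=v_i$ and $E_{i,j}v_m=0$ for $m\ne j$; all sums run over indices in $\{1,\dots,n\}$. $H_k(v,t)$ is the unital associative $\mathbb{Q}(v,t)$-algebra with generators $T_i$, $1\le i<k$, and relations: $T_iT_{i+1}T_i=T_{i+1}T_iT_{i+1}$ for $1\le i<k-1$; $T_iT_j=T_jT_i$ if $|i-j|\ge2$; $(T_i-v^{-1}t)(T_i+vt)=0$ for $1\le i<k$. $V_n$ is the underlying space of the natural representation of the two-parameter quantum algebra $U_{v,t}(sl_n)$; the claim concerns only the operators $R_i$ on the vector space $V_n^{\otimes k}$. *)

(* Defs.v *)
From HB Require Import structures.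
From mathcomp Require Import all_boot all_order all_algebra.
From mathcomp Require Import generic_quotient fraction.
From mathcomp.classical Require Import boolp.
From mathcomp.multinomials Require Import monalg.
From mathcomp.real_closed Require Import mxtens.

Set Implicit Arguments.
Unset Strict Implicit.
Unset Printing Implicit Defensive.

Import GRing.Theory.
Local Open Scope ring_scope.
Local Open Scope quotient_scope.

(* The free K-algebra on I is the monoid algebra of the free monoid on I. *)
Notation free_alg K I := {malg K[{fmonom I}]}.

Definition free_gen (K : fieldType) (I : choiceType) (i : I) : free_alg K I :=
  mkmalgU (fmu i) 1.

Section PresentedAlgebra.
Variables (K : fieldType) (I : choiceType).
Local Notation F := (free_alg K I).

Lemma free_scalerAr (a : K) (x y : F) : a *: (x * y) = x * (a *: y).
Proof.
suff xa : x * a%:MP = a *: x.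
  by rewrite scalerAl -xa -mulrA; congr (_ * _); exact: mul_malgC.
rewrite [LHS]fgmulgU [RHS]malgZ_def /fgscale.
by apply: eq_bigr => m _; rewrite mulm1 mulrC.
Qed.

(* The two-sided ideal generated by r. *)
Inductive gen_ideal (r : F -> Prop) : F -> Prop :=
| GenIdeal_gen x : r x -> gen_ideal r x
| GenIdeal_0 : gen_ideal r 0
| GenIdeal_D x y : gen_ideal r x -> gen_ideal r y -> gen_ideal r (x + y)
| GenIdeal_M a x b : gen_ideal r x -> gen_ideal r (a * x * b).

Variable r : F -> Prop.

Definition ideal_equiv (x y : F) : bool := `[< gen_ideal r (x - y) >].

Lemma gen_idealN x : gen_ideal r x -> gen_ideal r (- x).
Proof. by move=> /(GenIdeal_M (-1) 1); rewrite mulr1 mulN1r. Qed.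

Lemma ideal_equiv_is_equiv : equiv_class_of ideal_equiv.
Proof.
have sym x y : ideal_equiv x y -> ideal_equiv y x.
  by move=> /asboolP /gen_idealN xy; apply/asboolP; rewrite -opprB.
split=> [x|x y|y x z].
- by apply/asboolP; rewrite subrr; exact: GenIdeal_0.
- by apply/idP/idP; exact: sym.
- move=> /asboolP xy /asboolP yz; apply/asboolP.
  by rewrite -(subrKA y); exact: GenIdeal_D.
Qed.

Canonical ideal_equivRel := EquivRelPack ideal_equiv_is_equiv.

(* The K-algebra with generators I and relations x = 0 for r x. *)
Definition presented := {eq_quot ideal_equivRel}.
HB.instance Definition _ := Choice.on presented.
HB.instance Definition _ := EqQuotient.on presented.

Definition pr (x : F) : presented := \pi_presented x.

Lemma prP x y : pr x = pr y <-> gen_ideal r (x - y).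
Proof.
rewrite /pr; split=> [/eqmodP/asboolP //|h].
by apply/eqmodP/asboolP.
Qed.

Lemma prW (P : presented -> Prop) : (forall x, P (pr x)) -> forall q, P q.
Proof. by move=> Ppr q; rewrite -[q]reprK; exact: Ppr. Qed.

Lemma pr_repr x : gen_ideal r (repr (pr x) - x).
Proof. by apply/prP; rewrite /pr reprK. Qed.

Definition padd (p q : presented) := pr (repr p + repr q).
Definition popp (p : presented) := pr (- repr p).
Definition pmul (p q : presented) := pr (repr p * repr q).
Definition pscale (a : K) (p : presented) := pr (a *: repr p).

Lemma paddE x y : padd (pr x) (pr y) = pr (x + y).
Proof. by apply/prP; rewrite opprD addrACA; apply: GenIdeal_D; exact: pr_repr. Qed.

Lemma poppE x : popp (pr x) = pr (- x).
Proof. by apply/prP; rewrite -opprD; apply: gen_idealN; exact: pr_repr. Qed.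

Lemma pmulE x y : pmul (pr x) (pr y) = pr (x * y).
Proof.
apply/prP; set x' := repr _; set y' := repr _.
have -> : x' * y' - x * y = 1 * (x' - x) * y' + x * (y' - y) * 1.
  by rewrite mul1r mulr1 mulrBl mulrBr addrA subrK.
by apply: GenIdeal_D; apply: GenIdeal_M; exact: pr_repr.
Qed.

Lemma pscaleE a x : pscale a (pr x) = pr (a *: x).
Proof.
apply/prP; rewrite -scalerBr -[X in a *: X]mul1r scalerAl -[X in gen_ideal _ X]mulr1.
by apply: GenIdeal_M; exact: pr_repr.
Qed.

Lemma paddA : associative padd.
Proof. by do 3!elim/prW => ?; rewrite !paddE addrA. Qed.
Lemma paddC : commutative padd.
Proof. by do 2!elim/prW => ?; rewrite !paddE addrC. Qed.
Lemma padd0 : left_id (pr 0) padd.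
Proof. by elim/prW => ?; rewrite paddE add0r. Qed.
Lemma paddN : left_inverse (pr 0) popp padd.
Proof. by elim/prW => ?; rewrite poppE paddE addNr. Qed.

HB.instance Definition _ :=
  GRing.isZmodule.Build presented paddA paddC padd0 paddN.

Lemma prD x y : pr (x + y) = pr x + pr y.
Proof. by rewrite -[RHS]/(padd _ _) paddE. Qed.

Lemma pmulA : associative pmul.
Proof. by do 3!elim/prW => ?; rewrite !pmulE mulrA. Qed.
Lemma pmul1l : left_id (pr 1) pmul.
Proof. by elim/prW => ?; rewrite pmulE mul1r. Qed.
Lemma pmul1r : right_id (pr 1) pmul.
Proof. by elim/prW => ?; rewrite pmulE mulr1. Qed.
Lemma pmulDl : left_distributive pmul +%R.
Proof. by do 3!elim/prW => ?; rewrite -prD !pmulE -prD mulrDl. Qed.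
Lemma pmulDr : right_distributive pmul +%R.
Proof. by do 3!elim/prW => ?; rewrite -prD !pmulE -prD mulrDr. Qed.

HB.instance Definition _ :=
  GRing.Zmodule_isPzRing.Build presented pmulA pmul1l pmul1r pmulDl pmulDr.

Lemma prM x y : pr (x * y) = pr x * pr y.
Proof. by rewrite -[RHS]/(pmul _ _) pmulE. Qed.

Lemma pscaleA a b p : pscale a (pscale b p) = pscale (a * b) p.
Proof. by elim/prW: p => x; rewrite !pscaleE scalerA. Qed.
Lemma pscale1 : left_id 1 pscale.
Proof. by elim/prW => x; rewrite pscaleE scale1r. Qed.
Lemma pscaleDr : right_distributive pscale +%R.
Proof. by move=> a; do 2!elim/prW => ?; rewrite -prD !pscaleE -prD scalerDr. Qed.
Lemma pscaleDl p : {morph pscale^~ p : a b / a + b}.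
Proof. by elim/prW: p => x a b; rewrite !pscaleE -prD scalerDl. Qed.

HB.instance Definition _ :=
  GRing.Zmodule_isLmodule.Build K presented pscaleA pscale1 pscaleDr pscaleDl.

Lemma prZ a x : pr (a *: x) = a *: pr x.
Proof. by rewrite -[RHS]/(pscale _ _) pscaleE. Qed.

Lemma pscaleAl a (p q : presented) : a *: (p * q) = (a *: p) * q.
Proof.
by elim/prW: p => x; elim/prW: q => y; rewrite -prM -!prZ -prM scalerAl.
Qed.
Lemma pscaleAr a (p q : presented) : a *: (p * q) = p * (a *: q).
Proof.
by elim/prW: p => x; elim/prW: q => y; rewrite -prM -!prZ -prM free_scalerAr.
Qed.


Lemma presented_eq0 x : r x -> pr x = 0.
Proof. by move=> rx; apply/prP; rewrite subr0; exact: GenIdeal_gen. Qed.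

End PresentedAlgebra.

Section Hecke.
Variables (K : fieldType) (v t : K) (k : nat).

Local Notation I := 'I_k.-1.
Local Notation X := (@free_gen K I).

(* 'I_k.-1 numbers the generators from 0: index i stands for T_{i+1}. *)
Inductive hecke_rel : free_alg K I -> Prop :=
| Hecke_braid (i j : I) : j = i.+1 :> nat ->
    hecke_rel (X i * X j * X i - X j * X i * X j)
| Hecke_comm (i j : I) : (i.+2 <= j)%N || (j.+2 <= i)%N ->
    hecke_rel (X i * X j - X j * X i)
| Hecke_quad (i : I) :
    hecke_rel ((X i - (v^-1 * t)%:A) * (X i + (v * t)%:A)).

Definition hecke := presented hecke_rel.
HB.instance Definition _ := GRing.PzRing.on hecke.
HB.instance Definition _ := GRing.Lmodule.on hecke.

Definition hecke_gen (i : I) : hecke := pr hecke_rel (X i).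

Definition hecke_char (m : {fmonom I}) : K := (v^-1 * t) ^+ fdeg m.

Fact hecke_char_mmorphism : mmorphism hecke_char.
Proof. by split=> [x y|]; rewrite /hecke_char ?fdegM ?exprD ?fdeg1. Qed.

#[local] HB.instance Definition _ :=
  isMultiplicative.Build _ _ hecke_char hecke_char_mmorphism.

(* The character T_i |-> v^-1 t shows that hecke is not the zero ring. *)
Lemma hecke_oner_neq0 : (1 : hecke) != 0.
Proof.
pose e : {malg K[{fmonom I}]} -> K := mmap idfun hecke_char.
have e00 : e 0 = 0 by exact: mmap0.
have eD : {morph e : x y / x + y} by exact: mmapD.
have eB : {morph e : x y / x - y} by exact: mmapB.
have e1 : e 1 = 1 by exact: mmap1.
have eM : {morph e : x y / x * y} by exact: rmorphM.
have eX i : e (X i) = v^-1 * t by rewrite /e mmapU mul1r /hecke_char fdegU expr1.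
have eC a : e (a%:A) = a by rewrite /e mmapZ mmap1 mulr1.
have eS a b c : e a = c -> e b = c -> e (a - b) = 0.
  by move=> ea eb; rewrite eB ea eb subrr.
have e3 i j l : e (X i * X j * X l) = (v^-1 * t) * (v^-1 * t) * (v^-1 * t).
  by rewrite 2!eM 3!eX.
clearbody e.
suff e0 x : gen_ideal hecke_rel x -> e x = 0.
  apply/eqP => /prP /e0 /eqP; rewrite subr0.
  by rewrite e1 oner_eq0.
elim=> {x} [x []|||].
- by move=> i j _; apply: eS; rewrite e3.
- by move=> i j _; apply: eS; rewrite eM 2!eX.
- by move=> i; rewrite eM eB eX eC subrr mul0r.
- exact: e00.
- by move=> x y _ x0 _ y0; rewrite eD x0 y0 addr0.
- by move=> a x b _ x0; rewrite !eM x0 mulr0 mul0r.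
Qed.

HB.instance Definition _ :=
  GRing.PzSemiRing_isNonZero.Build hecke hecke_oner_neq0.
HB.instance Definition _ :=
  GRing.Lmodule_isLalgebra.Build K hecke (@pscaleAl _ _ hecke_rel).
HB.instance Definition _ :=
  GRing.Lalgebra_isAlgebra.Build K hecke (@pscaleAr _ _ hecke_rel).

End Hecke.

Section RMatrix.
Variables (K : fieldType) (v t : K) (n : nat).

Local Notation E i j := (delta_mx i j : 'M[K]_n).

(* Matrices act on column vectors, V_n = 'cV_n with v_j = delta_mx j 0, and
   'cV_(n * n) is the tensor square through the Kronecker product *t. *)
Definition Rmx : 'M[K]_(n * n) :=
  \sum_(i < n) \sum_(j < n | (i < j)%N) t ^+ 2 *: (E j i *t E i j)
  + \sum_(i < n) \sum_(j < n | (i < j)%N) E i j *t E j i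
  + ((v^-1 - v) * t) *: (\sum_(i < n) \sum_(j < n | (i < j)%N) E j j *t E i i)
  + (v^-1 * t) *: (\sum_(i < n) E i i *t E i i).

Variable k : nat.

Lemma tens_dim (i : 'I_k.-1) : (n ^ i * (n * n) * n ^ (k - i.+2) = n ^ k)%N.
Proof.
rewrite mulnA -!expnSr -expnD subnKC //.
by case: k i => [|k'] [].
Qed.

(* 'cV_(n ^ k) is the k-th tensor power; since i counts from 0, there are i
   factors to the left of the two on which R acts. *)
Definition Ri (i : 'I_k.-1) : 'M[K]_(n ^ k) :=
  castmx (tens_dim i, tens_dim i)
    ((1%:M : 'M_(n ^ i)) *t Rmx *t (1%:M : 'M_(n ^ (k - i.+2)))).

End RMatrix.

(* Q(v,t) is the fraction field of Q[v][t]: the inner indeterminate is v, the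
   outer one is t. *)
Definition Qvt : fieldType := {fraction {poly {poly rat}}}.
Definition v : Qvt := FracField.tofrac ('X%:P : {poly {poly rat}}).
Definition t : Qvt := FracField.tofrac ('X : {poly {poly rat}}).

(* Main.v *)
Require Import Defs.
From HB Require Import structures.
From mathcomp Require Import all_boot all_order all_algebra.
From mathcomp Require Import ring zify.
From mathcomp.multinomials Require Import monalg.
From mathcomp.real_closed Require Import mxtens.

Import GRing.Theory.
Local Open Scope ring_scope.

Set Implicit Arguments.
Unset Strict Implicit.
Unset Printing Implicit Defensive.

(** The Hecke algebra is given by generators and relations, so a representation
on a space of dimension N is the same thing as a family of N x N matrices that
satisfy the relations: the family extends to the free algebra by evaluating
words, the evaluation kills the ideal of relations, and the resulting morphism
is the only one because words span the free algebra
([hecke_mx_representation]).  What remains is to check the relations for the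
operators R_i.

Each R_i is R tensored with identities on both sides, and padding a matrix with
identities is a ring morphism ([padM], [padD], [pad_scalar]) whose composites
are again paddings ([pad_pad]).  Hence the quadratic relation only has to be
checked on the tensor square and the braid relation only on the tensor cube,
while R_i and R_j act on disjoint factors, and so commute, when i and j are far
apart ([pad_comm]).

On basis vectors, R exchanges the two factors up to a scalar and adds a multiple
of the vector itself; both coefficients depend only on how the two indices
compare ([Rmx_action]).  Thus e_a (x) e_a is an eigenvector for v^-1 t, and for
distinct a and b the span of e_a (x) e_b and e_b (x) e_a is preserved by R, which
acts there with determinant - t ^ 2 and trace (v^-1 - v) t: the quadratic
relation is Cayley-Hamilton.  Likewise the two sides of the braid
relation map e_a (x) e_b (x) e_c to combinations of the permuted tensors, and
their coefficients agree for each of the thirteen possible relative orders of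
a, b and c. *)

(** * Morphisms out of a free algebra *)

Section FreeEval.
Variables (K : fieldType) (I : choiceType) (A : algType K) (a : I -> A).

Definition word_eval (m : {fmonom I}) : A := \prod_(i <- m) a i.

Fact word_eval_mmorphism : mmorphism word_eval.
Proof.
by split=> [x y|]; rewrite /word_eval ?fmM ?fm1 ?big_cat ?big_nil.
Qed.

HB.instance Definition _ :=
  isMultiplicative.Build _ _ word_eval word_eval_mmorphism.

Definition free_eval : free_alg K I -> A := mmap (in_alg A) word_eval.

Lemma free_evalD : {morph free_eval : x y / x + y}.
Proof. exact: mmapD. Qed.

Lemma free_evalB : {morph free_eval : x y / x - y}.
Proof. exact: mmapB. Qed.

Lemma free_eval0 : free_eval 0 = 0.
Proof. exact: mmap0. Qed.

(** A product of scaled words evaluates correctly because scalars are central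
in A. *)
Lemma free_eval_monoid_morphism : monoid_morphism free_eval.
Proof.
have fM : multiplicative free_eval.
  apply: commr_mmap_is_multiplicative => g m m'.
  by rewrite /GRing.comm /= mulr_algl mulr_algr.
by case: fM.
Qed.

Lemma free_evalM : {morph free_eval : x y / x * y}.
Proof. by case: free_eval_monoid_morphism. Qed.

Lemma free_eval1 : free_eval 1 = 1.
Proof. by case: free_eval_monoid_morphism. Qed.

Lemma free_evalZ c x : free_eval (c *: x) = c *: free_eval x.
Proof. by rewrite /free_eval mmapZ /= mulr_algl. Qed.

Lemma free_eval_gen i : free_eval (free_gen K i) = a i.
Proof.
by rewrite /free_eval /free_gen mmapU /= scale1r mul1r /word_eval fmU big_seq1.
Qed.

Lemma free_eval_ideal (r : free_alg K I -> Prop) :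
  (forall x, r x -> free_eval x = 0) ->
  forall x, gen_ideal r x -> free_eval x = 0.
Proof.
move=> r0 x; elim=> {x} [x /r0 //||x y _ x0 _ y0|x y z _ y0].
- exact: free_eval0.
- by rewrite free_evalD x0 y0 addr0.
- by rewrite !free_evalM y0 mulr0 mul0r.
Qed.
End FreeEval.

Lemma free_alg_ind (K : fieldType) (I : choiceType) (P : free_alg K I -> Prop) :
  P 0 -> P 1 -> (forall x y, P x -> P y -> P (x + y)) ->
  (forall c x, P x -> P (c *: x)) ->
  (forall i x, P x -> P (free_gen K i * x)) -> forall x, P x.
Proof.
move=> P0 P1 PD PZ PM x; rewrite (monalgE x).
elim/big_ind: _ => // m _.
have -> : << x@_m *g m >> = x@_m *: << 1 *g m >> :> free_alg K I.
  by apply/malgP => y; rewrite mcoeffZ !mcoeffU mulrnAr mulr1.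
apply: PZ; case: m => s; elim: s => [|i s IHs].
  rewrite (_ : << _ *g _ >> = 1) //; congr (mkmalgU _ _).
  by apply/eqP; rewrite fmP fm1.
rewrite (_ : << _ *g _ >> = free_gen K i * << 1 *g FMonom s >>).
  exact: PM.
rewrite /free_gen malgM_def fgmulUU mulr1; congr (mkmalgU _ _).
by apply/eqP; rewrite fmP fmM fmU.
Qed.

(** * The universal property of the Hecke algebra *)

Section HeckeUniversal.
Variables (K : fieldType) (v t : K) (k : nat).
Local Notation H := (hecke v t k).

Section Lift.
Variables (A : algType K) (a : 'I_k.-1 -> A).
Hypothesis braid : forall i j : 'I_k.-1, j = i.+1 :> nat ->
  a i * a j * a i = a j * a i * a j.
Hypothesis far_comm : forall i j : 'I_k.-1, (i.+2 <= j)%N ->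
  a i * a j = a j * a i.
Hypothesis quad : forall i, (a i - (v^-1 * t)%:A) * (a i + (v * t)%:A) = 0.

Local Notation ev := (free_eval a).

Lemma hecke_rel_eval x : @hecke_rel K v t k x -> ev x = 0.
Proof.
pose e : {malg K[{fmonom 'I_k.-1}]} -> A := free_eval a.
have eB : {morph e : x y / x - y} by exact: free_evalB.
have eD : {morph e : x y / x + y} by exact: free_evalD.
have eM : {morph e : x y / x * y} by exact: free_evalM.
have eX i : e (free_gen K i) = a i by exact: free_eval_gen.
have eC c : e c%:A = c%:A by rewrite /e free_evalZ free_eval1.
have eqB y z c : e y = c -> e z = c -> e (y - z) = 0.
  by move=> ey ez; rewrite eB ey ez subrr.
have e2 i j : e (free_gen K i * free_gen K j) = a i * a j by rewrite eM 2!eX.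
have e3 i j l : e (free_gen K i * free_gen K j * free_gen K l)
    = a i * a j * a l by rewrite 2!eM 3!eX.
have eXB i c : e (free_gen K i - c%:A) = a i - c%:A by rewrite eB eX eC.
have eXD i c : e (free_gen K i + c%:A) = a i + c%:A by rewrite eD eX eC.
rewrite -/(e x); clearbody e; case: x / => [i j ij|i j ij|i].
- by apply: eqB (e3 _ _ _) _; rewrite e3 (braid ij).
- apply: eqB (e2 _ _) _; rewrite e2.
  by case/orP: ij => /far_comm ->.
- by rewrite eM eXB eXD quad.
Qed.

(** Evaluating an arbitrary representative is harmless, because evaluation
vanishes on the ideal of relations. *)
Definition hecke_lift (h : H) : A := ev (repr h).

Lemma hecke_lift_pr x : hecke_lift (pr _ x) = ev x.
Proof.
apply/eqP; rewrite -subr_eq0 -free_evalB; apply/eqP.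
exact/(free_eval_ideal hecke_rel_eval)/pr_repr.
Qed.

Fact hecke_lift_additive : {morph hecke_lift : x y / x - y}.
Proof.
elim/prW => x; elim/prW => y.
have -> : pr (@hecke_rel K v t k) x - pr _ y = pr _ (x - y) :> H.
  by rewrite prD -poppE.
by rewrite !hecke_lift_pr free_evalB.
Qed.

Fact hecke_lift_monoid_morphism : monoid_morphism hecke_lift.
Proof.
split=> [|]; first exact: etrans (hecke_lift_pr 1) (free_eval1 a).
elim/prW => x; elim/prW => y.
have -> : pr (@hecke_rel K v t k) x * pr _ y = pr _ (x * y) :> H.
  by rewrite prM.
by rewrite !hecke_lift_pr free_evalM.
Qed.

Fact hecke_lift_scalable : scalable hecke_lift.
Proof.
move=> c; elim/prW => x.
have -> : c *: pr (@hecke_rel K v t k) x = pr _ (c *: x) :> H by rewrite prZ.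
by rewrite !hecke_lift_pr free_evalZ.
Qed.

HB.instance Definition _ :=
  GRing.isZmodMorphism.Build H A hecke_lift hecke_lift_additive.
HB.instance Definition _ :=
  GRing.isMonoidMorphism.Build H A hecke_lift hecke_lift_monoid_morphism.
HB.instance Definition _ :=
  GRing.isScalable.Build K H A *:%R hecke_lift hecke_lift_scalable.

Lemma hecke_liftP :
  exists delta : {lrmorphism H -> A}, forall i, delta (hecke_gen v t i) = a i.
Proof. by exists hecke_lift => i; rewrite /= hecke_lift_pr free_eval_gen. Qed.
End Lift.

Lemma eq_hecke_morph (A : algType K) (f g : {lrmorphism H -> A}) :
  (forall i, f (hecke_gen v t i) = g (hecke_gen v t i)) -> f =1 g.
Proof.
move=> fg; elim/prW; elim/free_alg_ind => [||x y fgx fgy|c x fgx|i x fgx].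
- by rewrite (_ : pr _ 0 = 0 :> H) ?rmorph0.
- by rewrite (_ : pr _ 1 = 1 :> H) ?rmorph1.
- have -> : pr _ (x + y) = pr _ x + pr _ y :> H by rewrite prD.
  by rewrite !rmorphD; congr (_ + _).
- have -> : pr _ (c *: x) = c *: (pr _ x : H) by rewrite prZ.
  by rewrite !linearZ; congr (_ *: _).
- have -> : pr _ (free_gen K i * x) = hecke_gen v t i * pr _ x :> H.
    by rewrite prM.
  by rewrite !rmorphM; congr (_ * _); [exact: fg | exact: fgx].
Qed.

(** The universal property for matrix algebras, with a size N that need not be
syntactically a successor, as is the case for n ^ k; 0 < N makes the matrix ring
nontrivial. *)
Lemma hecke_mx_representation N (a : 'I_k.-1 -> 'M[K]_N) : (0 < N)%N ->
  (forall i j : 'I_k.-1, j = i.+1 :> nat ->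
    a i *m a j *m a i = a j *m a i *m a j) ->
  (forall i j : 'I_k.-1, (i.+2 <= j)%N -> a i *m a j = a j *m a i) ->
  (forall i, (a i - (v^-1 * t)%:M) *m (a i + (v * t)%:M) = 0) ->
  exists delta : {lrmorphism H -> 'M[K]_N},
    (forall i, delta (hecke_gen v t i) = a i) /\
    (forall delta' : {lrmorphism H -> 'M[K]_N},
      (forall i, delta' (hecke_gen v t i) = a i) -> delta' =1 delta).
Proof.
case: N a => // N a _ braid far_comm quad.
have [|delta deltaE] := @hecke_liftP 'M[K]_N.+1 a braid far_comm.
  by move=> i; move: (quad i); rewrite -scalemx1 -[(v * t)%:M]scalemx1.
exists delta; split=> // delta' delta'E.
by apply: (@eq_hecke_morph 'M[K]_N.+1) => i; rewrite delta'E deltaE.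
Qed.
End HeckeUniversal.

(** * Tensor products of matrices *)

Lemma tens_castl (K : comPzRingType) m m' n n' p q (em : m = m') (en : n = n')
    (A : 'M[K]_(m, n)) (B : 'M_(p, q)) :
  castmx (em, en) A *t B =
    castmx (congr1 (muln^~ p) em, congr1 (muln^~ q) en) (A *t B).
Proof. by case: m' / em; case: n' / en; rewrite !castmx_id. Qed.

Lemma tensmxA (K : comPzRingType) m n p q r s
    (A : 'M[K]_(m, n)) (B : 'M_(p, q)) (C : 'M_(r, s)) :
  A *t (B *t C) =
    castmx (esym (mulnA m p r), esym (mulnA n q s)) (A *t B *t C).
Proof.
rewrite -[LHS](castmxK (mulnA m p r) (mulnA n q s)).
congr castmx; apply/esym/matrixP => i j.
case: (mxtens_indexP i) => i' i3; case: (mxtens_indexP j) => j' j3.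
case: (mxtens_indexP i') => i1 i2; case: (mxtens_indexP j') => j1 j2.
have castE a b c (k1 : 'I_a) (k2 : 'I_b) (k3 : 'I_c) :
  cast_ord (esym (mulnA a b c)) (mxtens_index (mxtens_index (k1, k2), k3))
  = mxtens_index (k1, mxtens_index (k2, k3)).
  by apply: val_inj; rewrite /= mulnDl -mulnA addnA.
by rewrite castmxE /= !castE !tensmxE mulrA.
Qed.

Lemma tensmx11 (K : comPzRingType) m n :
  (1%:M : 'M[K]_m) *t (1%:M : 'M_n) = 1%:M.
Proof.
apply/matrixP => i j.
case: (mxtens_indexP i) => i1 i2; case: (mxtens_indexP j) => j1 j2.
by rewrite tensmxE !mxE (can_eq (@mxtens_indexK _ _)) xpair_eqE -natrM mulnb.
Qed.

Section TensLinear.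
Variables (K : comPzRingType) (m n p q : nat).
Implicit Types (A : 'M[K]_(m, n)) (B : 'M[K]_(p, q)).
Lemma tensmxDl A A' B : (A + A') *t B = A *t B + A' *t B.
Proof. by apply/matrixP => i j; rewrite !mxE mulrDl. Qed.
Lemma tensmxDr A B B' : A *t (B + B') = A *t B + A *t B'.
Proof. by apply/matrixP => i j; rewrite !mxE mulrDr. Qed.
Lemma tensmxZl c A B : (c *: A) *t B = c *: (A *t B).
Proof. by apply/matrixP => i j; rewrite !mxE mulrA. Qed.
Lemma tensmxZr c A B : A *t (c *: B) = c *: (A *t B).
Proof. by apply/matrixP => i j; rewrite !mxE mulrCA. Qed.
End TensLinear.

(** * Padding a matrix with identities *)

Section Pad.
Variable K : fieldType.

(** The operator A on the middle factor of a threefold tensor product.  The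
total dimension N is kept free so that one matrix algebra, such as that of size
n ^ k, can receive paddings with different decompositions. *)
Definition pad p q m N (e : (p * m * q = N)%N) (A : 'M[K]_m) : 'M_N :=
  castmx (e, e) ((1%:M : 'M_p) *t A *t (1%:M : 'M_q)).

Section Morphism.
Variables (p q m N : nat) (e : (p * m * q = N)%N).
Implicit Types A B : 'M[K]_m.

Lemma padM A B : pad e (A *m B) = pad e A *m pad e B.
Proof.
by rewrite /pad; case: N / e; rewrite !castmx_id !tensmx_mul !mulmx1.
Qed.
Lemma padD A B : pad e (A + B) = pad e A + pad e B.
Proof. by rewrite /pad tensmxDr tensmxDl; case: N / e; rewrite !castmx_id. Qed.
Lemma padZ c A : pad e (c *: A) = c *: pad e A.
Proof. by rewrite /pad tensmxZr tensmxZl; case: N / e; rewrite !castmx_id. Qed.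
Lemma pad1 : pad e 1%:M = 1%:M.
Proof. by rewrite /pad !tensmx11; case: N / e; rewrite !castmx_id. Qed.
Lemma pad_scalar c : pad e c%:M = c%:M.
Proof. by rewrite -scalemx1 padZ pad1 scalemx1. Qed.
Lemma pad0 : pad e 0 = 0.
Proof. by rewrite -[0 in LHS](scale0r 0) padZ scale0r. Qed.
End Morphism.

Lemma pad_pad p q p' q' P Q m m' N (e : (p * m * q = N)%N)
    (e' : (p' * m' * q' = m)%N) (e'' : (P * m' * Q = N)%N) (A : 'M[K]_m') :
  (p * p')%N = P -> (q' * q)%N = Q -> pad e (pad e' A) = pad e'' A.
Proof.
move=> hP hQ; subst P Q m N; rewrite /pad !castmx_id -2!tensmx11.
rewrite [in RHS]tensmxA [1%:M *t (_ *t 1%:M)]tensmxA.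
rewrite [1%:M *t (_ *t A)]tensmxA !tens_castl.
by rewrite !castmx_comp; congr (castmx (_, _) _); apply: eq_irrelevance.
Qed.

Lemma padl m q N (e : (1 * m * q = N)%N) (e' : (m * q = N)%N) (A : 'M[K]_m) :
  pad e A = castmx (e', e') (A *t (1%:M : 'M_q)).
Proof.
case: N / e' e => e.
by rewrite /pad tens_scalar_mx scale1r tens_castl castmx_comp !castmx_id.
Qed.

Lemma padr p m N (e : (p * m * 1 = N)%N) (e' : (p * m = N)%N) (A : 'M[K]_m) :
  pad e A = castmx (e', e') ((1%:M : 'M_p) *t A).
Proof.
case: N / e' e => e.
by rewrite /pad tens_mx_scalar scale1r castmx_comp !castmx_id.
Qed.

(** A acts on the first of three factors and B on the last one, so both products
are A tensored with the identity and B. *)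
Lemma pad_comm m r m' (e : (1 * m * (r * m') = m * r * m')%N)
    (e' : (m * r * m' * 1 = m * r * m')%N) (A : 'M[K]_m) (B : 'M[K]_m') :
  pad e A *m pad e' B = pad e' B *m pad e A.
Proof.
have -> : pad e A = A *t (1%:M : 'M_r) *t (1%:M : 'M_m').
  by rewrite (padl _ (mulnA _ _ _)) -tensmx11 tensmxA castmxKV.
rewrite (padr _ erefl) castmx_id -tensmx11.
by rewrite !tensmx_mul !mulmx1 !mul1mx.
Qed.

End Pad.

(** * The R-matrix on tensors of basis vectors *)

Lemma eq_mx_delta (K : pzRingType) p n (A B : 'M[K]_(p, n)) :
  (forall j, A *m delta_mx j (0 : 'I_1) = B *m delta_mx j 0) -> A = B.
Proof.
move=> AB; apply/matrixP => i j.
by have /matrixP/(_ i 0) := AB j; rewrite -!colE !mxE.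
Qed.

Section TensorBasis.
Variables (K : fieldType) (m n : nat).

Lemma tens_delta (i : 'I_m) (j : 'I_n) :
  delta_mx i (0 : 'I_1) *t delta_mx j (0 : 'I_1)
  = delta_mx (mxtens_index (i, j)) 0 :> 'cV[K]_(m * n).
Proof.
apply/matrixP => x y.
case: (mxtens_indexP x) => x1 x2; rewrite !mxE mxtens_indexK.
by rewrite !ord1 !eqxx !andbT (can_eq (@mxtens_indexK _ _)) -natrM mulnb.
Qed.

Lemma eq_mx_tens p (A B : 'M[K]_(p, m * n)) :
  (forall i j, A *m (delta_mx i (0 : 'I_1) *t delta_mx j (0 : 'I_1))
             = B *m (delta_mx i 0 *t delta_mx j 0)) -> A = B.
Proof.
move=> AB; apply: eq_mx_delta => x; case: (mxtens_indexP x) => i j.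
by rewrite -tens_delta AB.
Qed.
End TensorBasis.

Section RMatrixAction.
Variables (K : fieldType) (v t : K) (n : nat).
Hypothesis v0 : v != 0.

Local Notation R := (Rmx v t n).
Local Notation e i := (delta_mx i 0 : 'cV[K]_n).

(** On the diagonal the two basis tensors involved in [Rmx_action] coincide, so
the eigenvalue v^-1 t can be split freely between the two coefficients.  It is
all put into [swap_coef]. *)
Definition swap_coef (a b : 'I_n) : K :=
  if (a < b)%N then t ^+ 2 else if (b < a)%N then 1 else v^-1 * t.
Definition fix_coef (a b : 'I_n) : K :=
  if (b < a)%N then (v^-1 - v) * t else 0.

Local Notation E i j := (delta_mx i j : 'M[K]_n).

Lemma tens_unit_action (i j k l a b : 'I_n) :
  (E i j *t E k l) *m (e a *t e b) =
  ((a == j) && (b == l))%:R *: (e i *t e k).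
Proof.
rewrite tensmx_mul !mul_delta_mx_cond (eq_sym a) (eq_sym b).
by do 2!case: eqP => _;
  rewrite ?mulr1n ?mulr0n ?tens0mx ?tensmx0 ?scale1r ?scale0r.
Qed.

(** A single term survives, and only if it lies in the range i < j; the failure
of that condition is what makes the coefficients of R depend on the order of
a and b. *)
Lemma sum_lt_delta (V : lmodType K) (F : 'I_n -> 'I_n -> V) (a b : 'I_n) :
  \sum_(i < n) \sum_(j < n | (i < j)%N) ((a == i) && (b == j))%:R *: F i j
  = if (a < b)%N then F a b else 0.
Proof.
rewrite pair_big_dep; case: ifP => ab; last first.
  apply: big1 => -[i j] /= ij; case: andP => [[/eqP ai /eqP bj]|_].
    by rewrite ai bj ij in ab.
  by rewrite scale0r.
rewrite (bigD1 (a, b)) //= !eqxx scale1r big1 ?addr0 // => -[i j] /andP[_].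
by rewrite xpair_eqE (eq_sym i) (eq_sym j) => /negPf ->; rewrite scale0r.
Qed.

Lemma Rmx_action a b :
  R *m (e a *t e b) =
  swap_coef a b *: (e b *t e a) + fix_coef a b *: (e a *t e b).
Proof.
have sum_action (F : 'I_n -> 'I_n -> 'M[K]_(n * n)) c d G :
    (forall i j, F i j *m (e a *t e b) = ((c == i) && (d == j))%:R *: G i j) ->
  (\sum_(i < n) \sum_(j < n | (i < j)%N) F i j) *m (e a *t e b)
  = if (c < d)%N then G c d else 0.
  move=> FG; rewrite -sum_lt_delta mulmx_suml; apply: eq_bigr => i _.
  by rewrite mulmx_suml; apply: eq_bigr => j _; exact: FG.
rewrite /Rmx !mulmxDl -!scalemxAl.
rewrite (sum_action _ a b (fun i j => t ^+ 2 *: (e j *t e i))); last first.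
  by move=> i j; rewrite -scalemxAl tens_unit_action !scalerA mulrC.
rewrite (sum_action _ b a (fun i j => e i *t e j)); last first.
  by move=> i j; rewrite tens_unit_action andbC.
rewrite (sum_action _ b a (fun i j => e j *t e i)); last first.
  by move=> i j; rewrite tens_unit_action andbC.
have -> : (\sum_i E i i *t E i i) *m (e a *t e b) =
    (a == b)%:R *: (e a *t e b).
  rewrite mulmx_suml (bigD1 a) //= tens_unit_action eqxx (eq_sym b).
  rewrite big1 => [|i /negPf ia]; last first.
    by rewrite tens_unit_action (eq_sym a) ia scale0r.
  by rewrite addr0; case: eqVneq => [->|_]; rewrite ?scale0r.
rewrite /swap_coef /fix_coef -val_eqE /=.
case: ltngtP => [_|_|/val_inj ->].
- by rewrite scale0r !scaler0 !addr0.
- by rewrite scale0r scaler0 add0r addr0 scale1r.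
- by rewrite scaler0 !add0r scale1r scale0r addr0.
Qed.

Lemma Rmx_quad : (R - (v^-1 * t)%:M) *m (R + (v * t)%:M) = 0.
Proof.
have shift c p (A : 'M_(_, p)) : (R + c%:M) *m A = R *m A + c *: A.
  by rewrite mulmxDl mul_scalar_mx.
rewrite -(raddfN scalar_mx); apply: eq_mx_tens => a b.
rewrite mul0mx -mulmxA !shift Rmx_action !mulmxDr -!scalemxAr !Rmx_action.
rewrite /swap_coef /fix_coef.
case: ltngtP => [_|_|/val_inj ->]; apply/matrixP => x y; rewrite !mxE.
- by field.
- by field.
- by ring.
Qed.

Local Notation e3 a b c := (e a *t e b *t e c).

Lemma Rmx_left_action a b c :
  (R *t (1%:M : 'M_n)) *m e3 a b c =
  swap_coef a b *: e3 b a c + fix_coef a b *: e3 a b c.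
Proof. by rewrite tensmx_mul Rmx_action mul1mx tensmxDl !tensmxZl. Qed.

Let n3 := mulnA n n n.

Lemma Rmx_right_action a b c :
  castmx (n3, n3) ((1%:M : 'M_n) *t R) *m e3 a b c =
  swap_coef b c *: e3 a c b + fix_coef b c *: e3 a b c.
Proof.
have e3E x y z : e3 x y z = castmx (n3, erefl) (e x *t (e y *t e z)).
  by rewrite tensmxA castmx_comp castmx_id.
rewrite !e3E; case: _ / n3; rewrite !castmx_id tensmx_mul mul1mx Rmx_action.
by rewrite tensmxDr !tensmxZr.
Qed.

Lemma Rmx_braid :
  let R1 := R *t (1%:M : 'M_n) in
  let R2 := castmx (n3, n3) ((1%:M : 'M_n) *t R) in
  R1 *m R2 *m R1 = R2 *m R1 *m R2.
Proof.
move=> R1 R2; apply: eq_mx_tens => ij c.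
case: (mxtens_indexP ij) => a b {ij}; rewrite -tens_delta -!mulmxA.
pose w x y z := e3 x y z; rewrite -/(w a b c).
have R1E x y z : R1 *m w x y z =
    swap_coef x y *: w y x z + fix_coef x y *: w x y z.
  exact: Rmx_left_action.
have R2E x y z : R2 *m w x y z =
    swap_coef y z *: w x z y + fix_coef y z *: w x y z.
  exact: Rmx_right_action.
clearbody w R1 R2.
(* Each side is a composite of three operators, each of which splits every
   tensor into two: three rounds of expansion. *)
do 3!rewrite ?(R1E, R2E, mulmxDr) -?scalemxAr.
rewrite /swap_coef /fix_coef.
(* Of the 27 combinations of comparisons, 13 are consistent. *)
case: (ltngtP a b) => [ab|ba|/val_inj ab];
case: (ltngtP b c) => [bc|cb|/val_inj bc];
case: (ltngtP a c) => [ac|ca|/val_inj ac]; subst; try by lia.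
all: by rewrite ?ltnn; apply/matrixP => x y; rewrite !mxE; field.
Qed.

End RMatrixAction.

(** * The Hecke relations on the tensor power *)

Section HeckeRelations.
Variables (K : fieldType) (v t : K) (n k : nat).

Local Notation R := (Rmx v t n).
Local Notation R_ := (Ri v t n).

Lemma Ri_pad (i : 'I_k.-1) : R_ i = pad (tens_dim n i) R.
Proof. by []. Qed.

(** The tensor factors form five blocks: those before i, the pair i, i+1, those
strictly between i+1 and j, the pair j, j+1, and those after j+1.  Both operators
live on the three middle blocks, where [pad_comm] applies. *)
Lemma Ri_far_comm (i j : 'I_k.-1) : (i.+2 <= j)%N ->
  R_ i *m R_ j = R_ j *m R_ i.
Proof.
move=> ij; have jk : (j.+2 <= k)%N by move: (ltn_ord j); lia.
pose r := (n ^ (j - i.+2))%N.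
have dim : (n ^ i * (n * n * r * (n * n)) * n ^ (k - j.+2) = n ^ k)%N.
  by rewrite /r !mulnA -!(expnSr, expnD); congr (_ ^ _)%N; lia.
have e1 : (1 * (n * n) * (r * (n * n)) = n * n * r * (n * n))%N.
  by rewrite mul1n !mulnA.
have e2 : (n * n * r * (n * n) * 1 = n * n * r * (n * n))%N by rewrite muln1.
have RiE : R_ i = pad dim (pad e1 R).
  rewrite Ri_pad; apply/esym/pad_pad; rewrite ?muln1 //.
  by rewrite /r !mulnA -!(expnSr, expnD); congr (_ ^ _)%N; lia.
have RjE : R_ j = pad dim (pad e2 R).
  rewrite Ri_pad; apply/esym/pad_pad; rewrite ?mul1n //.
  by rewrite /r !mulnA -!(expnSr, expnD); congr (_ ^ _)%N; lia.
by rewrite RiE RjE -!padM pad_comm.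
Qed.

Hypothesis v0 : v != 0.

Lemma Ri_quad (i : 'I_k.-1) :
  (R_ i - (v^-1 * t)%:M) *m (R_ i + (v * t)%:M) = 0.
Proof.
have padN c : - c%:M = pad (tens_dim n i) (- c%:M).
  by rewrite -[in RHS]scaleN1r padZ pad_scalar scaleN1r.
by rewrite Ri_pad padN -(pad_scalar (tens_dim n i) (v * t)) -!padD -padM
  Rmx_quad ?pad0.
Qed.

(** Both operators live on the three consecutive factors i, i+1 and i+2. *)
Lemma Ri_braid (i j : 'I_k.-1) : j = i.+1 :> nat ->
  R_ i *m R_ j *m R_ i = R_ j *m R_ i *m R_ j.
Proof.
move=> ij.
have jk : (j.+2 <= k)%N by move: (ltn_ord j); lia.
have dim3 : (n ^ i * (n * n * n) * n ^ (k - i.+3) = n ^ k)%N.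
  by rewrite !mulnA -!(expnSr, expnD); congr (_ ^ _)%N; lia.
have e1 : (1 * (n * n) * n = n * n * n)%N by rewrite mul1n.
have e2 : (n * (n * n) * 1 = n * n * n)%N by rewrite muln1 mulnA.
have RiE : R_ i = pad dim3 (R *t (1%:M : 'M_n)).
  rewrite Ri_pad -[_ *t _](castmx_id (erefl, erefl)) -(padl e1).
  by apply/esym/pad_pad; rewrite ?muln1 // -expnS; congr (_ ^ _)%N; lia.
have RjE : R_ j = pad dim3
    (castmx (mulnA n n n, mulnA n n n) ((1%:M : 'M_n) *t R)).
  rewrite Ri_pad -(padr e2); apply/esym/pad_pad.
    by rewrite -expnSr ij.
  by rewrite mul1n ij.
by rewrite RiE RjE -!padM Rmx_braid.
Qed.

End HeckeRelations.

Lemma v_neq0 : v != 0.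
Proof. by rewrite /v tofrac_eq0 polyC_eq0 polyX_eq0. Qed.

Unset Implicit Arguments.
Set Strict Implicit.

Theorem proposition5 (n k : nat) (hn : (2 <= n)%N) (hk : (2 <= k)%N) :
  exists delta : {lrmorphism hecke v t k -> 'M[Qvt]_(n ^ k)},
    (forall i : 'I_k.-1, delta (hecke_gen v t i) = Ri v t n i)
    /\ (forall delta' : {lrmorphism hecke v t k -> 'M[Qvt]_(n ^ k)},
          (forall i : 'I_k.-1, delta' (hecke_gen v t i) = Ri v t n i) ->
          delta' =1 delta).
Proof.
apply: hecke_mx_representation => [|i j|i j|i].
- by rewrite expn_gt0 (ltnW hn).
- exact: Ri_braid v_neq0 _ _.
- exact: Ri_far_comm.
- exact: Ri_quad v_neq0 _.
Qed.
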